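(* Let $n,k$ be positive integers with $n\ge k+1$ and consider the $k$-nearest neighbor platoon $\mathcal{P}(n,k)$. Suppose that the faulty vehicles form an $\lfloor\frac{k-1}{2}\rfloor$-local set in $\mathcal{P}(n,k)$. Then resilient asymptotic consensus on $\mathcal{P}(n,k)$ is reached under the W-MSR dynamics (with parameter $f=\lfloor\frac{k-1}{2}\rfloor$), despite the action of the faulty vehicles.
   Context: The $k$-nearest neighbor platoon $\mathcal{P}(n,k)$ is the undirected simple graph on vertices $v_1,\dots,v_n$ (vehicles in a line, in this order) in which each vertex is adjacent to its $k$ nearest vertices in front and its $k$ nearest vertices behind (or all of those, when fewer than $k$ exist); that is, $v_i$ and $v_j$ are adjacent iff $1\le |i-j|\le k$. Let $\mathcal{N}_i$ be the set of neighbors of $v_i$ and $\mathcal{V}$ the vertex set. $f$-local set: a set $\mathcal{S}\subset\mathcal{V}$ is $f$-local if $|\mathcal{N}_i\cap\mathcal{S}|\le f$ for every $v_i\in\mathcal{V}\setminus\mathcal{S}$ (at all times). W-MSR dynamics with parameter $f$: each vehicle $v_j$ holds a real state $x_j[t]$, $t=0,1,2,\dots$, which is the value seen by all its neighbors. At each time step $t$, each non-faulty vehicle $v_j$ disregards the $f$ largest and the $f$ smallest values among its neighbors' values ($2f$ values in total; ties broken arbitrarily). Let $\mathcal{N}_j[t]\subset\mathcal{N}_j$ denote the neighbors that are not ignored. Then $$x_j[t+1]=w_{jj}x_j[t]+\sum_{p\in\mathcal{N}_j[t]}w_{jp}x_p[t],$$ where the weights satisfy $w_{jp}>0$ for all $p\in\mathcal{N}_j[t]\cup\{v_j\}$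 and $\sum_{p\in\mathcal{N}_j[t]\cup\{v_j\}}w_{jp}=1$ for all $v_j$ and all $t$. A faulty vehicle may deviate arbitrarily from this rule (an arbitrary real value $\phi_j[t]$ is added to its update at each step). The set of faulty vehicles is fixed and unknown to the non-faulty ones, which know only the bound $f$. Resilient asymptotic consensus: for every choice of initial states and every behavior of the faulty vehicles, (i) all non-faulty vehicles' states converge to a common limit as $t\to\infty$, and (ii) the state of every non-faulty vehicle remains for all $t$ in the interval between the minimum and maximum initial states of the non-faulty vehicles. *)

(* Defs.v *)
From HB Require Import structures.
From mathcomp Require Import all_boot all_order all_algebra.
From mathcomp Require Import all_classical all_reals all_analysis.
Set Implicit Arguments.
Unset Strict Implicit.
Unset Printing Implicit Defensive.
Import Order.TTheory GRing.Theory Num.Theory.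
Import numFieldNormedType.Exports.
Local Open Scope ring_scope.

(* The vehicle v_{i+1} is the ordinal i : 'I_n. *)
Definition platoon (n k : nat) : rel 'I_n :=
  fun i j => (1 <= `|i - j| <= k)%N.

Definition neighbors (V : finType) (e : rel V) (i : V) : {set V} :=
  [set j | e i j].

Definition f_local (V : finType) (e : rel V) (f : nat) (S : {set V}) : Prop :=
  forall i : V, i \notin S -> (#|neighbors e i :&: S| <= f)%N.

(* K is what may remain of N once f largest and f smallest values of y on N are
   discarded. The two discarded sets are disjoint, so 2f vehicles are dropped
   even when values coincide; any choice among ties is allowed. *)
Definition wmsr_retained (R : realType) (V : finType) (f : nat) (y : V -> R)
    (N K : {set V}) : Prop :=
  exists H L : {set V},
    [/\ [/\ H \subset N, L \subset N & [disjoint H & L]],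
        #|H| = f /\ #|L| = f,
        forall p q, p \in H -> q \in N :\: H -> y q <= y p,
        forall p q, p \in L -> q \in N :\: L -> y p <= y q
      & K = N :\: (H :|: L)].

(* x t j is the state of j at time t, K t j the set of neighbors that j does not
   ignore at time t, and w t j p the weight that j gives to p at time t. The
   weights have to sum to 1 over K t j and j, a set that varies with t, so they
   may vary with t as well; their positivity is then required uniformly in t, as
   convergence fails for weights that vanish too fast (e.g. self-weights tending
   to 1 summably). By wmsr_invariant_weights below, plain positivity is enough as
   soon as the weights depend on time only through the retained set.
   Nothing is required of the vehicles in S: adding an arbitrary real to the
   update of a faulty vehicle makes its next state an arbitrary real. *)
Definition wmsr_dynamics (R : realType) (V : finType) (e : rel V) (f : nat)
    (S : {set V}) (K : nat -> V -> {set V}) (w : nat -> V -> V -> R)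
    (x : nat -> V -> R) : Prop :=
  [/\ forall t j, j \notin S -> wmsr_retained f (x t) (neighbors e j) (K t j),
      exists2 alpha : R, 0 < alpha &
        forall t j p, j \notin S -> p \in j |: K t j -> alpha <= w t j p,
      forall t j, j \notin S -> \sum_(p in j |: K t j) w t j p = 1
    & forall t j, j \notin S ->
        x t.+1 j = w t j j * x t j + \sum_(p in K t j) w t j p * x t p].

Lemma wmsr_invariant_weights (R : realType) (V : finType) (e : rel V) (f : nat)
    (S : {set V}) (K : nat -> V -> {set V}) (w : {set V} -> V -> V -> R)
    (x : nat -> V -> R) :
  (forall t j, j \notin S -> wmsr_retained f (x t) (neighbors e j) (K t j)) ->
  (forall t j p, j \notin S -> p \in j |: K t j -> 0 < w (K t j) j p) ->
  (forall t j, j \notin S -> \sum_(p in j |: K t j) w (K t j) j p = 1) ->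
  (forall t j, j \notin S -> x t.+1 j =
     w (K t j) j j * x t j + \sum_(p in K t j) w (K t j) j p * x t p) ->
  wmsr_dynamics e f S K (fun t j p => w (K t j) j p) x.
Proof.
move=> hK w_gt0 w1 hx; split=> //.
pose u (a : {set V} * V * V) := w a.1.1 a.1.2 a.2.
exists (\big[Num.min/1]_(a | 0 < u a) u a).
  by elim/big_ind: _ => // a b a0 b0; rewrite lt_min a0.
move=> t j p jS pK; have wp := w_gt0 t j p jS pK.
exact: (@bigmin_le_cond _ _ _ 1 (K t j, j, p) (fun a => 0 < u a) u wp).
Qed.

(* In the second clause j itself is non-faulty, so taking x 0 j as the base value
   of the iterated minimum and maximum does not alter them. *)
Definition resilient_asymptotic_consensus (R : realType) (V : finType)
    (e : rel V) (f : nat) (S : {set V}) : Prop :=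
  forall (K : nat -> V -> {set V}) (w : nat -> V -> V -> R) (x : nat -> V -> R),
    wmsr_dynamics e f S K w x ->
    (exists l : R, forall j, j \notin S -> ((fun t => x t j) @ \oo --> l)%classic) /\
    (forall t j, j \notin S ->
       \big[Num.min/x 0%N j]_(p | p \notin S) x 0%N p <= x t j
         <= \big[Num.max/x 0%N j]_(p | p \notin S) x 0%N p).

(* Main.v *)
Require Import Defs.
From HB Require Import structures.
From mathcomp Require Import all_boot all_order all_algebra.
From mathcomp Require Import all_classical all_reals all_analysis.
From mathcomp Require Import zify ring lra.
Import Order.TTheory GRing.Theory Num.Theory.
Import numFieldNormedType.Exports.
Local Open Scope ring_scope.

(** Let [f = (k - 1) %/ 2], so that [2f < k], and call a vehicle honest when it
    is not faulty.

    Safety. An honest vehicle has at most [f] faulty neighbors, hence at most [f]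
    neighbors whose value exceeds every honest value, and trimming the [f] largest
    values removes all of them; the same holds below. So each honest update is a
    convex combination of values lying between the extreme honest values
    ([wmsr_retained_le], [wmsr_within_preserved]).

    Convergence. Let [a, b] contain the honest values at time [t], and for
    [s >= 0] put [d = alpha ^+ s * (b - a) / 2], where [alpha] is a lower bound
    of the weights. Let [X] be the set of vehicles above [b - d] at time [t + s]
    and [Y] the set of those below [a + d]; they are disjoint. An honest vehicle
    outside [X] stays outside, because its own weight is at least [alpha] and the
    margin shrinks by the factor [alpha] only. An honest vehicle in [X] with more
    than [f] neighbors outside [X] leaves it, because it cannot discard all of
    these low neighbors ([wmsr_retained_has_le]). If the graph guarantees that, as
    long as [X] and [Y] both contain honest vehicles, one of these has more than
    [f] neighbors outside its set ([fault_robust]), then one of the two sets has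
    lost all its honest vehicles after [#|V|] steps. At that moment the honest
    values lie in an interval that is shorter by a factor independent of [t]
    ([wmsr_contraction]), which yields a common limit ([wmsr_consensus]).

    The platoon. Suppose that every honest vehicle of [X] has at most [f]
    neighbors outside [X]. If [k] vehicles are behind it, at most [f] of these are
    faulty and at most [f] are outside [X], so one of the [k > 2f] is again
    honest and in [X]. Hence [X] has an honest vehicle among the last [k + 1]
    ([platoon_reaches_rear]). These last vehicles are pairwise adjacent, so at
    most [f] of them are outside [X]. If the same held for [Y], at most [2f < k]
    of these [k + 1] vehicles would be outside [X] or outside [Y]; but [X] and [Y]
    are disjoint, so all of them are ([platoon_fault_robust]). *)

Set Implicit Arguments.
Unset Strict Implicit.
Unset Printing Implicit Defensive.

(** * Honest ranges, superlevel sets and robustness *)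

Definition honest_within (R : realType) (V : finType) (S : {set V}) (y : V -> R)
    (a b : R) : Prop :=
  forall j, j \notin S -> a <= y j <= b.

Definition superlevel (R : realType) (V : finType) (y : V -> R) (c : R) : {set V} :=
  [set i | c < y i].

(** A robustness notion relative to a given faulty set: two groups with
    honest members cannot both be closed to the rest of the graph. [X] and [Y]
    may contain faulty vertices, because a faulty vehicle whose value happens to
    be extreme supports its group as an honest one would. *)
Definition fault_robust (V : finType) (e : rel V) (f : nat) (S : {set V}) :
    Prop :=
  forall X Y : {set V}, [disjoint X & Y] ->
    ~~ (X \subset S) -> ~~ (Y \subset S) ->
    (exists2 i, i \in X :\: S & (f < #|neighbors e i :\: X|)%N) \/
    (exists2 i, i \in Y :\: S & (f < #|neighbors e i :\: Y|)%N).

(** * Trimming extreme values *)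

(** The dynamics is invariant under a change of sign, which exchanges the two
    trimmed sets. Statements about small values thus follow from those about
    large values. *)
Lemma wmsr_retained_opp (R : realType) (V : finType) (f : nat) (y : V -> R)
    (N K : {set V}) :
  wmsr_retained f y N K -> wmsr_retained f (fun p => - y p) N K.
Proof.
move=> [H [L [[HN LN dHL] [cH cL] hH hL ->]]]; exists L, H.
split=> //; first by rewrite disjoint_sym.
- by move=> p q pL qL; rewrite lerN2; exact: hL.
- by move=> p q pH qH; rewrite lerN2; exact: hH.
- by rewrite finset.setUC.
Qed.

Lemma wmsr_dynamics_opp (R : realType) (V : finType) (e : rel V) (f : nat)
    (S : {set V}) (K : nat -> V -> {set V}) (w : nat -> V -> V -> R)
    (x : nat -> V -> R) :
  wmsr_dynamics e f S K w x -> wmsr_dynamics e f S K w (fun t j => - x t j).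
Proof.
move=> [hK hw w1 hx]; split=> // t j jS; first exact/wmsr_retained_opp/hK.
rewrite hx // opprD mulrN -sumrN; congr (_ + _).
by apply: eq_bigr => p _; rewrite mulrN.
Qed.

Lemma wmsr_retained_sub (R : realType) (V : finType) (f : nat) (y : V -> R)
    (N K : {set V}) :
  wmsr_retained f y N K -> K \subset N.
Proof. by move=> [H [L [_ _ _ _ ->]]]; exact: subsetDl. Qed.

(** If a retained value exceeded [b], so would the [f] trimmed largest ones,
    which makes [f + 1] in all. *)
Lemma wmsr_retained_le (R : realType) (V : finType) (f : nat) (y : V -> R)
    (N K : {set V}) (b : R) (p : V) :
  wmsr_retained f y N K -> (#|N :&: superlevel y b| <= f)%N -> p \in K -> y p <= b.
Proof.
move=> [H [L [[HN _ _] [cH _] hH _ ->]]] cN.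
rewrite !inE negb_or => /andP[/andP[pH pL] pN].
rewrite leNgt; apply/negP => bp.
have : p |: H \subset N :&: superlevel y b.
  apply/fintype.subsetP => q; rewrite !inE => /orP[/eqP->|qH]; first by rewrite pN.
  rewrite (fintype.subsetP HN) //=; apply: lt_le_trans bp _.
  by apply: hH => //; rewrite !inE pH.
by move/subset_leq_card; rewrite cardsU1 pH cH leqNgt add1n ltnS cN.
Qed.

(** One of the more than [f] low neighbors escapes the trimming from below. It
    can still be trimmed from above, but then everything retained is at most its
    value, and the degree assumption ensures that something is retained. *)
Lemma wmsr_retained_has_le (R : realType) (V : finType) (f : nat) (y : V -> R)
    (N K : {set V}) (c : R) :
  wmsr_retained f y N K -> (f.*2 < #|N|)%N -> (f < #|N :\: superlevel y c|)%N ->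
  exists2 p, p \in K & y p <= c.
Proof.
move=> [H [L [[HN LN dHL] [cH cL] hH _ ->]]] cN cT.
have [q qT qL] : exists2 q, q \in N :\: superlevel y c & q \notin L.
  apply/fintype.subsetPn; apply/negP => /subset_leq_card.
  by rewrite cL leqNgt cT.
move: qT; rewrite !inE -leNgt => /andP[yq qN].
have [qH|qH] := boolP (q \in H); last first.
  by exists q => //; rewrite !inE negb_or qH qL.
have [p pN pHL] : exists2 p, p \in N & p \notin H :|: L.
  apply/fintype.subsetPn; apply/negP => /subset_leq_card.
  rewrite leqNgt (leq_ltn_trans _ cN) // (leq_trans (leq_card_setU _ _)) //.
  by rewrite cH cL addnn.
exists p; first by rewrite inE pHL.
apply: le_trans yq; apply: hH => //.
by move: pHL; rewrite !inE negb_or => /andP[-> _].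
Qed.

(** * One step of the dynamics *)

Lemma convex_comb_le (R : realType) (V : finType) (A : {set V}) (w y : V -> R)
    (alpha b d : R) (p0 : V) :
  0 <= alpha -> (forall p, p \in A -> alpha <= w p) ->
  \sum_(p in A) w p = 1 -> (forall p, p \in A -> y p <= b) ->
  0 <= d -> p0 \in A -> y p0 <= b - d ->
  \sum_(p in A) w p * y p <= b - alpha * d.
Proof.
move=> a0 hw w1 hy d0 p0A yp0; rewrite lerBrDl -lerBrDr.
have -> : b - \sum_(p in A) w p * y p = \sum_(p in A) w p * (b - y p).
  rewrite -[b in LHS]mul1r -w1 mulr_suml -sumrB.
  by apply: eq_bigr => p _; rewrite mulrBr.
rewrite (bigD1 p0) //=; apply: ler_wpDr.
  apply: sumr_ge0 => p /andP[pA _].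
  by rewrite mulr_ge0 ?subr_ge0 ?hy // (le_trans a0) ?hw.
by rewrite ler_pM ?hw // lerBrDr addrC -lerBrDr.
Qed.

(** The only bound assumed on the states is one on honest values: faulty values
    above it are trimmed. The vehicle [p] may be [j] itself, which covers both the
    persistence of a margin and its acquisition from a neighbor. *)
Lemma wmsr_step_le (R : realType) (V : finType) (e : rel V) (f : nat)
    (S : {set V}) (K : nat -> V -> {set V}) (w : nat -> V -> V -> R)
    (x : nat -> V -> R) (alpha b d : R) (t : nat) (j : V) :
  irreflexive e -> f_local e f S -> wmsr_dynamics e f S K w x ->
  0 <= alpha ->
  (forall t j p, j \notin S -> p \in j |: K t j -> alpha <= w t j p) ->
  (forall i, i \notin S -> x t i <= b) -> j \notin S -> 0 <= d ->
  (exists2 p, p \in j |: K t j & x t p <= b - d) ->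
  x t.+1 j <= b - alpha * d.
Proof.
move=> irr loc [hK _ w1 hx] a0 hw hb jS d0 [p pK xp].
have jK : j \notin K t j.
  apply: contraTN isT => /(fintype.subsetP (wmsr_retained_sub (hK t j jS))).
  by rewrite inE irr.
rewrite hx // -(big_setU1 _ jK (F := fun p => w t j p * x t p)).
apply: (@convex_comb_le _ _ _ _ _ _ _ _ p) => //.
- by move=> q qK; exact: hw.
- exact: w1.
move=> q; rewrite in_setU1 => /predU1P[->|qK]; first exact: hb.
apply: (wmsr_retained_le (hK t j jS)) => //.
apply: leq_trans (loc j jS); apply/subset_leq_card/finset.setIS/fintype.subsetP => i.
by rewrite inE; apply: contraTT => iS; rewrite -leNgt hb.
Qed.

(** The threshold moves up from [b - d] to [b - alpha * d], which is what makes
    the honest parts of the superlevel sets nested. *)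
Lemma wmsr_superlevel_shrinks (R : realType) (V : finType) (e : rel V) (f : nat)
    (S : {set V}) (K : nat -> V -> {set V}) (w : nat -> V -> V -> R)
    (x : nat -> V -> R) (alpha b d : R) (t : nat) :
  irreflexive e -> f_local e f S ->
  (forall i, i \notin S -> (f.*2 < #|neighbors e i|)%N) ->
  wmsr_dynamics e f S K w x -> 0 <= alpha ->
  (forall t j p, j \notin S -> p \in j |: K t j -> alpha <= w t j p) ->
  (forall i, i \notin S -> x t i <= b) -> 0 <= d ->
  let X := superlevel (x t) (b - d) in
  let X' := superlevel (x t.+1) (b - alpha * d) in
  X' :\: S \subset X :\: S /\
  forall i, i \in X :\: S -> (f < #|neighbors e i :\: X|)%N ->
    X' :\: S \proper X :\: S.
Proof.
move=> irr loc deg dyn a0 hw hb d0 X X'.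
have sub : X' :\: S \subset X :\: S.
  apply/fintype.subsetP => i; rewrite !inE => /andP[iS]; rewrite iS /=.
  apply: contraTT; rewrite -!leNgt => xi.
  by apply: (@wmsr_step_le _ _ e f S K w) => //; exists i => //; exact: setU11.
split=> // i iX ci; apply/properP; split=> //; exists i => //.
move: iX; rewrite !inE => /andP[iS _]; rewrite iS /= -leNgt.
apply: (@wmsr_step_le _ _ e f S K w) => //.
have [hK _ _ _] := dyn.
have [p pK xp] := wmsr_retained_has_le (hK t i iS) (deg i iS) ci.
by exists p => //; rewrite in_setU1 pK orbT.
Qed.

Lemma wmsr_le_preserved (R : realType) (V : finType) (e : rel V) (f : nat)
    (S : {set V}) (K : nat -> V -> {set V}) (w : nat -> V -> V -> R)
    (x : nat -> V -> R) (b : R) (t s : nat) :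
  irreflexive e -> f_local e f S -> wmsr_dynamics e f S K w x ->
  (forall i, i \notin S -> x t i <= b) ->
  (forall i, i \notin S -> x (s + t)%N i <= b).
Proof.
move=> irr loc dyn hb; elim: s => // s IH i iS.
have [_ [alpha a0 hw] _ _] := dyn.
rewrite addSn -[b]subr0 -(mulr0 alpha).
apply: (@wmsr_step_le _ _ e f S K w) => //; first exact: ltW.
by exists i; [exact: setU11 | rewrite subr0 IH].
Qed.

Lemma wmsr_within_preserved (R : realType) (V : finType) (e : rel V) (f : nat)
    (S : {set V}) (K : nat -> V -> {set V}) (w : nat -> V -> V -> R)
    (x : nat -> V -> R) (a b : R) (t s : nat) :
  irreflexive e -> f_local e f S -> wmsr_dynamics e f S K w x ->
  honest_within S (x t) a b -> honest_within S (x (s + t)%N) a b.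
Proof.
move=> irr loc dyn hab j jS; apply/andP; split.
  rewrite -lerN2.
  apply: (@wmsr_le_preserved _ _ _ _ _ _ _ (fun t j => - x t j) _ _ _ irr loc
    (wmsr_dynamics_opp dyn)) => // i iS.
  by rewrite lerN2; have /andP[] := hab i iS.
apply: (wmsr_le_preserved (b := b) s irr loc dyn) => // i iS.
by have /andP[] := hab i iS.
Qed.

Lemma disjoint_superlevels (R : realType) (V : finType) (y : V -> R) (a b d : R) :
  d + d <= b - a ->
  [disjoint superlevel y (b - d) & superlevel (fun i => - y i) (- a - d)].
Proof.
move=> dab; rewrite disjoint_subset; apply/fintype.subsetP => i.
rewrite !inE => yi; rewrite -leNgt; lra.
Qed.

(** * Convergence *)

(** The honest members of [X s] and [Y s] together decrease in number at each
    step at which both are present, so that one kind is exhausted after [#|V|]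
    steps. *)
Lemma wmsr_contraction (R : realType) (V : finType) (e : rel V) (f : nat)
    (S : {set V}) (K : nat -> V -> {set V}) (w : nat -> V -> V -> R)
    (x : nat -> V -> R) :
  irreflexive e -> f_local e f S ->
  (forall i, i \notin S -> (f.*2 < #|neighbors e i|)%N) ->
  fault_robust e f S -> wmsr_dynamics e f S K w x ->
  exists2 r : R, 0 <= r < 1 &
    forall t a b, a <= b -> honest_within S (x t) a b ->
      exists a' b', [/\ a' <= b', b' - a' = r * (b - a)
                      & honest_within S (x (#|V| + t)%N) a' b'].
Proof.
move=> irr loc deg rob dyn.
have [_ [alpha0 alpha0_gt0 hw0] _ _] := dyn.
pose alpha := Num.min alpha0 1.
have a0 : 0 < alpha by rewrite lt_min alpha0_gt0 ltr01.
(* Without this bound the margins d s below could outgrow (b - a) / 2. *)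
have a1 : alpha <= 1 by rewrite ge_min lexx orbT.
have hw t j p : j \notin S -> p \in j |: K t j -> alpha <= w t j p.
  by move=> jS pK; rewrite ge_min hw0.
have an0 s : 0 < alpha ^+ s by rewrite exprn_gt0.
have an1 s : alpha ^+ s <= 1 by rewrite exprn_ile1 // ltW.
exists (1 - alpha ^+ #|V| / 2).
  by have := an0 #|V|; have := an1 #|V|; move: (alpha ^+ _) => z; lra.
move=> t a b ab hab.
pose d s := alpha ^+ s * ((b - a) / 2).
have hba : 0 <= (b - a) / 2 by lra.
have d0 s : 0 <= d s by exact: mulr_ge0 (ltW (an0 s)) hba.
have dS s : d s.+1 = alpha * d s by rewrite /d exprS mulrA.
have dab s : d s + d s <= b - a.
  have : d s <= (b - a) / 2 by rewrite ler_piMl.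
  by lra.
pose xN s i := - x s i.
pose X s := superlevel (x (s + t)%N) (b - d s).
pose Y s := superlevel (xN (s + t)%N) (- a - d s).
have stepX s : X s.+1 :\: S \subset X s :\: S /\ forall i, i \in X s :\: S ->
    (f < #|neighbors e i :\: X s|)%N -> X s.+1 :\: S \proper X s :\: S.
  rewrite /X dS addSn; apply: (wmsr_superlevel_shrinks irr loc deg dyn _ hw) => //.
    exact: ltW.
  by move=> i iS; have /andP[] := wmsr_within_preserved s irr loc dyn hab iS.
have stepY s : Y s.+1 :\: S \subset Y s :\: S /\ forall i, i \in Y s :\: S ->
    (f < #|neighbors e i :\: Y s|)%N -> Y s.+1 :\: S \proper Y s :\: S.
  rewrite /Y dS addSn.
  apply: (wmsr_superlevel_shrinks irr loc deg (wmsr_dynamics_opp dyn) _ hw) => //.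
    exact: ltW.
  move=> i iS; rewrite /xN lerN2.
  by have /andP[] := wmsr_within_preserved s irr loc dyn hab iS.
(* The count starts below the number of vehicles as the sets are disjoint, and
   once a set has no honest member this remains so. *)
have key s : [\/ X s \subset S, Y s \subset S
    | (#|X s :\: S| + #|Y s :\: S| + s <= #|V|)%N].
  elim: s => [|s IH].
    apply: Or33; rewrite addn0.
    have /eqP <- : #|X 0%N :\: S :|: Y 0%N :\: S|
                    == (#|X 0%N :\: S| + #|Y 0%N :\: S|)%N.
      rewrite leq_card_setU; apply: (disjointW (subsetDl _ _) (subsetDl _ _)).
      exact: disjoint_superlevels.
    exact: max_card.
  have [subX propX] := stepX s; have [subY propY] := stepY s.
  have [XS|/negbTE XS] := boolP (X s \subset S).
    apply: Or31; rewrite -finset.setD_eq0 -finset.subset0.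
    by apply: fintype.subset_trans subX _; rewrite finset.subset0 finset.setD_eq0.
  have [YS|/negbTE YS] := boolP (Y s \subset S).
    apply: Or32; rewrite -finset.setD_eq0 -finset.subset0.
    by apply: fintype.subset_trans subY _; rewrite finset.subset0 finset.setD_eq0.
  case: IH => [|| IH]; rewrite ?XS ?YS //; apply: Or33.
  rewrite addnS; apply: leq_trans IH; rewrite -addSn leq_add2r.
  have [||[i iX ci]|[i iY ci]] := rob (X s) (Y s) (disjoint_superlevels _ (dab s)).
  - by rewrite XS.
  - by rewrite YS.
  - by rewrite -addSn leq_add ?proper_card ?subset_leq_card ?(propX i).
  - by rewrite -addnS leq_add ?proper_card ?subset_leq_card ?(propY i).
have dr : b - a - d #|V| = (1 - alpha ^+ #|V| / 2) * (b - a).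
  by rewrite /d; field.
have hN := wmsr_within_preserved #|V| irr loc dyn hab.
have d_le : d #|V| <= b - a by have := dab #|V|; have := d0 #|V|; lra.
have XYS : X #|V| \subset S \/ Y #|V| \subset S.
  case: (key #|V|) => [XS|YS|]; [by left|by right|].
  rewrite -[leqRHS]add0n leq_add2r leqn0 addn_eq0 => /andP[+ _].
  by rewrite cards_eq0 finset.setD_eq0; left.
case: XYS => [/fintype.subsetP XS|/fintype.subsetP YS].
  exists a, (b - d #|V|); split=> [||j jS]; [lra|by rewrite -dr; ring|].
  have /andP[-> _] /= := hN j jS.
  by rewrite leNgt; apply: contra jS => jX; apply: XS; rewrite inE.
exists (a + d #|V|), b; split=> [||j jS]; [lra|by rewrite -dr; ring|].
have /andP[_ ->] := hN j jS; rewrite andbT -lerN2 opprD.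
by rewrite leNgt; apply: contra jS => jY; apply: YS; rewrite inE.
Qed.

Lemma wmsr_consensus (R : realType) (V : finType) (e : rel V) (f : nat)
    (S : {set V}) :
  irreflexive e -> f_local e f S ->
  (forall i, i \notin S -> (f.*2 < #|neighbors e i|)%N) ->
  fault_robust e f S -> resilient_asymptotic_consensus R e f S.
Proof.
move=> irr loc deg rob K w x dyn.
have hbox j : j \notin S -> honest_within S (x 0%N)
    (\big[Num.min/x 0%N j]_(p | p \notin S) x 0%N p)
    (\big[Num.max/x 0%N j]_(p | p \notin S) x 0%N p).
  by move=> jS i iS; rewrite bigmin_le_cond // le_bigmax_cond.
split; last first.
  move=> t j jS; rewrite -[t]addn0.
  exact: (wmsr_within_preserved t irr loc dyn (hbox j jS)).
have [VS|/fintype.subsetPn[j0 _ j0S]] := boolP ([set: V] \subset S).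
  by exists 0 => j; rewrite (fintype.subsetP VS).
have [r /andP[r0 r1] contr] := wmsr_contraction irr loc deg rob dyn.
have := hbox j0 j0S; set a0 := \big[_/_]_(_ | _) _.
set b0 := \big[_/_]_(_ | _) _ => box0.
have ab0 : a0 <= b0 by have /andP[/le_trans] := box0 j0 j0S; apply.
have boxq q : exists t a b, [/\ a <= b, b - a = r ^+ q * (b0 - a0)
    & honest_within S (x t) a b].
  elim: q => [|q [t [a [b [ab dab hab]]]]].
    by exists 0%N, a0, b0; rewrite expr0 mul1r.
  have [a' [b' [ab' dab' hab']]] := contr t a b ab hab.
  by exists (#|V| + t)%N, a', b'; rewrite dab' dab exprS mulrA.
have small (eps : R) : 0 < eps -> exists t a, forall s j, (t <= s)%N ->
    j \notin S -> a <= x s j < a + eps.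
  move=> eps0.
  have /cvgrPdist_lt : (GRing.exp r @ \oo --> (0 : R))%classic.
    by apply: cvg_expr; rewrite ger0_norm.
  (* The added 1 keeps the denominator positive if all honest values agree. *)
  move=> /(_ (eps / (b0 - a0 + 1))) [|q _ /(_ q (leqnn q))].
    by rewrite divr_gt0 //; lra.
  rewrite sub0r normrN ger0_norm ?exprn_ge0 // ltr_pdivlMr; last by lra.
  move=> rq; have [t [a [b [ab dab hab]]]] := boxq q; exists t, a => s j ts jS.
  have := wmsr_within_preserved (s - t) irr loc dyn hab jS.
  rewrite subnK // => /andP[-> xb] /=; apply: le_lt_trans xb _.
  have : 0 <= r ^+ q by rewrite exprn_ge0.
  move: rq dab; rewrite mulrDr mulr1; lra.
have cvg0 : cvg ((fun t => x t j0) @ \oo)%classic.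
  apply/cauchy_cvgP/cauchy_exP => eps eps0.
  have [t [a ha]] := small eps eps0; exists a; exists t => // s /= ts.
  by rewrite /ball /= ltr_distlC; have /andP[] := ha s j0 ts j0S; lra.
exists (lim ((fun t => x t j0) @ \oo)%classic) => j jS.
apply/cvgrPdist_lt => eps eps0.
have e2 : 0 < eps / 2 by rewrite divr_gt0.
have [t [a ha]] := small _ e2.
move/cvgrPdist_lt: (cvg0) => /(_ _ e2) [t' _ ht'].
exists (maxn t t') => // s /=; rewrite geq_max => /andP[ts t's].
have := ht' s t's; have := ha s j ts jS; have := ha s j0 ts j0S.
by rewrite !ltr_distl; lra.
Qed.

(** * Robustness of the platoon *)

Definition block (n : nat) (a m : nat) : {set 'I_n} :=
  [set j : 'I_n | (a <= j <= a + m)%N].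

Lemma card_block (n a m : nat) : (a + m < n)%N -> #|block n a m| = m.+1.
Proof.
move=> amn.
have lt_n (s : 'I_m.+1) : (a + s < n)%N by have := ltn_ord s; lia.
have <- : [set Ordinal (lt_n s) | s : 'I_m.+1] = block n a m.
  apply/setP => j; rewrite inE; apply/imsetP/idP => [[s _ ->] /=|aj].
    by have := ltn_ord s; lia.
  have js : (j - a < m.+1)%N by lia.
  by exists (Ordinal js) => //; apply: val_inj => /=; lia.
rewrite card_imset ?card_ord // => s s' [ss']; apply: val_inj => /=; lia.
Qed.

Lemma platoon_irreflexive (n k : nat) : irreflexive (@platoon n k).
Proof. by move=> i; rewrite /platoon; lia. Qed.

Lemma block_neighbors (n k a : nat) (i : 'I_n) :
  i \in block n a k -> block n a k :\ i \subset neighbors (@platoon n k) i.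
Proof.
rewrite !inE => ai; apply/fintype.subsetP => j; rewrite !inE /platoon.
by rewrite -(inj_eq val_inj) /=; lia.
Qed.

Lemma platoon_degree (n k : nat) (i : 'I_n) :
  (k < n)%N -> (k <= #|neighbors (@platoon n k) i|)%N.
Proof.
move=> kn.
(* The block starting at i, or the last block if fewer than k vehicles follow. *)
pose a := minn i (n - k.+1).
have ltin := ltn_ord i; have akn : (a + k < n)%N by rewrite /a; lia.
have ia : i \in block n a k by rewrite inE /a; lia.
have := subset_leq_card (block_neighbors ia).
have := cardsD1 i (block n a k); rewrite ia (card_block akn) add1n => -[<-].
by [].
Qed.

(** Otherwise consider the honest vehicle of [X] closest to the rear: it has [k]
    vehicles behind it, each of which is faulty or outside [X], hence among at
    most [2f]. *)
Lemma platoon_reaches_rear (n k f : nat) (S X : {set 'I_n}) :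
  f_local (@platoon n k) f S -> (f.*2 < k)%N -> ~~ (X \subset S) ->
  (forall i, i \in X :\: S -> #|neighbors (@platoon n k) i :\: X| <= f)%N ->
  exists2 i, i \in X :\: S & (n - k.+1 <= i)%N.
Proof.
move=> loc fk /fintype.subsetPn[i0 i0X i0S] hX.
have i0XS : i0 \in X :\: S by rewrite inE i0S.
case: (arg_maxnP (fun i : 'I_n => i : nat) i0XS) => i iM imax.
have iXS : i \in X :\: S by exact: iM.
exists i => //; rewrite leqNgt; apply/negP => ik.
have iB : i \in block n i k by rewrite inE; lia.
have iS : i \notin S by move: iXS; rewrite inE => /andP[].
have sub : block n i k :\ i \subset
    (neighbors (@platoon n k) i :&: S) :|: (neighbors (@platoon n k) i :\: X).
  apply/fintype.subsetP => j jB.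
  have jN := fintype.subsetP (block_neighbors iB) j jB.
  have jX : j \notin X :\: S.
    apply: contraL jB => /imax ji;
      rewrite !inE -(inj_eq val_inj) /=; lia.
  rewrite finset.in_setU finset.in_setI finset.in_setD jN andbT /=.
  by move: jX; rewrite finset.in_setD negb_and negbK.
have := cardsD1 i (block n i k); rewrite iB card_block ?add1n; last lia.
move=> [kE]; have := subset_leq_card sub; rewrite -kE.
have := leq_card_setU (neighbors (@platoon n k) i :&: S)
                      (neighbors (@platoon n k) i :\: X).
have := loc i iS; have := hX i iXS; move=> c1 c2 [c3 _] c4.
by have := leq_trans c4 c3; lia.
Qed.

(** The last [k + 1] vehicles form a clique that every closed group must enter,
    and it is too small to be closed to two disjoint groups. *)
Lemma platoon_fault_robust (n k f : nat) (S : {set 'I_n}) :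
  f_local (@platoon n k) f S -> (f.*2 < k)%N -> (k < n)%N ->
  fault_robust (@platoon n k) f S.
Proof.
move=> loc fk kn X Y dXY XS YS.
have [/exists_inP|noX] :=
  boolP [exists i in X :\: S, f < #|neighbors (@platoon n k) i :\: X|]%N.
  by left.
have [/exists_inP|noY] :=
  boolP [exists i in Y :\: S, f < #|neighbors (@platoon n k) i :\: Y|]%N.
  by right.
have hX i : i \in X :\: S -> (#|neighbors (@platoon n k) i :\: X| <= f)%N.
  by move=> iX; rewrite leqNgt; apply: contra noX => ci; apply/exists_inP; exists i.
have hY i : i \in Y :\: S -> (#|neighbors (@platoon n k) i :\: Y| <= f)%N.
  by move=> iY; rewrite leqNgt; apply: contra noY => ci; apply/exists_inP; exists i.
pose W := block n (n - k.+1) k.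
have inW (Z : {set 'I_n}) (i : 'I_n) : i \in Z :\: S -> (n - k.+1 <= i)%N ->
    (#|W :\: Z| <= #|neighbors (@platoon n k) i :\: Z|)%N.
  move=> iZ ni; have iW : i \in W by rewrite inE; have := ltn_ord i; lia.
  apply/subset_leq_card/fintype.subsetP => j.
  rewrite !finset.in_setD => /andP[jZ jW]; rewrite jZ /=.
  apply: (fintype.subsetP (block_neighbors iW)).
  rewrite finset.in_setD1 jW andbT.
  by apply: contraNneq jZ => ->; move: iZ; rewrite inE => /andP[].
have [i iX ni] := platoon_reaches_rear loc fk XS hX.
have [j jY nj] := platoon_reaches_rear loc fk YS hY.
have cX := leq_trans (inW X i iX ni) (hX i iX).
have cY := leq_trans (inW Y j jY nj) (hY j jY).
have sub : W \subset (W :\: X) :|: (W :\: Y).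
  apply/fintype.subsetP => p pW.
  rewrite finset.in_setU !finset.in_setD pW !andbT -negb_and.
  by apply/andP => -[pX pY]; rewrite (disjointFr dXY pX) in pY.
have := subset_leq_card sub; rewrite card_block; last lia.
have [c _] := leq_card_setU (W :\: X) (W :\: Y) => c'.
by have := leq_trans c' c; lia.
Qed.

Theorem theorem4 (R : realType) (n k : nat) (hn : (0 < n)%N) (hk : (0 < k)%N)
    (hnk : (k + 1 <= n)%N) (S : {set 'I_n})
    (hS : f_local (@platoon n k) ((k - 1) %/ 2)%N S) :
  resilient_asymptotic_consensus R (@platoon n k) ((k - 1) %/ 2)%N S.
Proof.
have fk : (((k - 1) %/ 2).*2 < k)%N by lia.
have kn : (k < n)%N by rewrite -addn1.
apply: (wmsr_consensus _ hS).
- exact: platoon_irreflexive.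
- by move=> i _; apply: leq_trans fk _; exact: platoon_degree.
- exact: platoon_fault_robust.
Qed.
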